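(* Let $\langle X,\tau,\tau_S\rangle$ be the dual space of an S4-subordination algebra $\langle A,\prec\rangle$. Then the following two conditions are equivalent: (i) for all $a,b\in A$, if $a\prec b$, then there exists $c\in A$ such that $c\prec c$ and $a\leq c\leq b$; (ii) $\leq_S$ is separated.
   Context: A subordination on a Boolean algebra $A$ is a binary relation $\prec$ on $A$ such that: (S1) $0\prec 0$ and $1\prec 1$; (S2) $a\prec b$ and $a\prec c$ imply $a\prec b\wedge c$; (S3) $a\prec c$ and $b\prec c$ imply $a\vee b\prec c$; (S4) $a\leq b\prec c\leq d$ implies $a\prec d$. The pair $\langle A,\prec\rangle$ is an S4-subordination algebra if moreover (S5) $a\prec b$ implies $a\leq b$, and (S6) $a\prec b$ implies that there is $c\in A$ with $a\prec c\prec b$. The dual space $\langle X,\tau,\tau_S\rangle$ of an S4-subordination algebra $\langle A,\prec\rangle$ is: $X=\mathrm{Ul}(A)$, the set of ultrafilters of $A$; $\tau$ is the Stone topology with base $\{\varphi(a):a\in A\}$, $\varphi(a)=\{x\in X:a\in x\}$; $\tau_S$ is the topology with base the sets $\beta({\downarrow}a)=\{x\in X:x\cap{\downarrow}a\neq\emptyset\}$, $a\in A$, where ${\downarrow}a=\{b\in A:b\prec a\}$. $\mathrm{Clop}(X)$ is the set of clopen subsets of $\langle X,\tau\rangle$; $\mathrm{int}_S$ denotes interior with respect to $\tau_S$. For $x,y\in X$, $x\leq_S y$ iff for all $U\in\mathrm{Clop}(X)$, $x\in\mathrm{int}_S(U)$ implies $y\in\mathrm{int}_S(U)$. The preorder $\leq_S$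 is separated if for all $x,y\in X$ with $x\nleq_S y$ there exists $U\in\mathrm{Clop}(X)$ such that $x\in U$, $y\notin U$ and $U=\mathrm{int}_S(U)$. *)

(* Defs.v *)
From HB Require Import structures.
From mathcomp Require Import all_boot all_order.
From mathcomp Require Import all_classical topology_structure.

Set Implicit Arguments.
Unset Strict Implicit.
Unset Printing Implicit Defensive.

Import Order.LTheory.

Local Open Scope classical_set_scope.

(* Boolean algebras are MathComp's [ctbDistrLatticeType]s; the one-element
   algebra (\bot = \top) is allowed. *)

HB.mixin Record isSubordination (d : Order.disp_t) A
    of Order.CTBDistrLattice d A := {
  prec : A -> A -> Prop;
  prec00 : prec (\bot : A)%O (\bot : A)%O;
  prec11 : prec (\top : A)%O (\top : A)%O;
  prec_meet : forall a b c : A, prec a b -> prec a c -> prec a (b `&` c)%O;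
  prec_join : forall a b c : A, prec a c -> prec b c -> prec (a `|` b)%O c;
  prec_mono : forall a b c d' : A,
    (a <= b)%O -> prec b c -> (c <= d')%O -> prec a d'
}.

#[short(type="subordinationAlgType")]
HB.structure Definition SubordinationAlg (d : Order.disp_t) :=
  { A of Order.CTBDistrLattice d A & isSubordination d A }.

HB.mixin Record isS4Subordination (d : Order.disp_t) A
    of SubordinationAlg d A := {
  prec_le : forall a b : A, prec a b -> (a <= b)%O;
  prec_dense : forall a b : A, prec a b -> exists c : A, prec a c /\ prec c b
}.

#[short(type="s4SubordinationAlgType")]
HB.structure Definition S4SubordinationAlg (d : Order.disp_t) :=
  { A of SubordinationAlg d A & isS4Subordination d A }.

Notation "a ≺ b" := (prec a b) (at level 70, no associativity).

Section Ultrafilters.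
Context (d : Order.disp_t) (A : ctbDistrLatticeType d).

Definition is_filter (F : set A) : Prop :=
  [/\ F \top%O,
      (forall a b : A, F a -> F b -> F (a `&` b)%O) &
      (forall a b : A, (a <= b)%O -> F a -> F b)].

Definition is_proper_filter (F : set A) : Prop := is_filter F /\ ~ F \bot%O.

Definition is_ultrafilter (F : set A) : Prop :=
  is_proper_filter F /\
  (forall G : set A, is_proper_filter G -> F `<=` G -> G = F).

Record Ul := MkUl {
  ul_set :> set A;
  ul_setP : is_ultrafilter ul_set
}.

Definition phi (a : A) : set Ul := [set x : Ul | (x : set A) a].

Lemma phi_cover : \bigcup_(U in range phi) U = [set: Ul].
Proof.
apply/seteqP; split=> // x _; exists (phi \top%O); first by exists \top%O.
by case: (ul_setP x) => -[[]].
Qed.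

Lemma phi_joint (U V : set Ul) (x : Ul) :
  range phi U -> range phi V -> U x -> V x ->
  exists W : set Ul, [/\ range phi W, W x & W `<=` U `&` V].
Proof.
move=> [a _ <-] [b _ <-] xa xb; exists (phi (a `&` b)%O); split.
- by exists (a `&` b)%O.
- by case: (ul_setP x) => -[[_ xI _] _] _; apply: xI.
- move=> y yab; case: (ul_setP y) => -[[_ _ yU] _] _.
  by split; apply: yU yab; rewrite (leIl, leIr).
Qed.

End Ultrafilters.

HB.instance Definition _ (d : Order.disp_t) (A : ctbDistrLatticeType d) :=
  gen_eqMixin (Ul A).
HB.instance Definition _ (d : Order.disp_t) (A : ctbDistrLatticeType d) :=
  gen_choiceMixin (Ul A).

(* The Stone topology tau is the canonical topology of [Ul A]. *)
HB.instance Definition _ (d : Order.disp_t) (A : ctbDistrLatticeType d) :=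
  isBaseTopological.Build (Ul A) (@phi_cover d A) (@phi_joint d A).

Section SubordinationTopology.
Context (d : Order.disp_t) (A : s4SubordinationAlgType d).

(* An alias of [Ul A], whose canonical topology is tau_S instead of tau. *)
Definition UlS : Type := Ul A.

Definition prec_down (a : A) : set A := [set b : A | b ≺ a].

Definition beta (F : set A) : set UlS :=
  [set x : Ul A | (x : set A) `&` F !=set0].

Lemma beta_cover : \bigcup_(U in range (beta \o prec_down)) U = [set: UlS].
Proof.
apply/seteqP; split=> // x _.
exists (beta (prec_down \top%O)); first by exists \top%O.
by exists \top%O; split; [case: (ul_setP x) => -[[]] | exact: prec11].
Qed.

Lemma beta_joint (U V : set UlS) (x : UlS) :
  range (beta \o prec_down) U -> range (beta \o prec_down) V -> U x -> V x ->
  exists W : set UlS, [/\ range (beta \o prec_down) W, W x & W `<=` U `&` V].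
Proof.
move=> [a _ <-] [b _ <-] [a' [xa' a'a]] [b' [xb' b'b]].
exists (beta (prec_down (a `&` b)%O)); split.
- by exists (a `&` b)%O.
- exists (a' `&` b')%O; split.
    by case: (ul_setP x) => -[[_ xI _] _] _; apply: xI.
  apply: prec_meet; first exact: prec_mono (leIl _ _) a'a (lexx _).
  exact: prec_mono (leIr _ _) b'b (lexx _).
- move=> y [c [yc cab]]; split; exists c; split=> //.
    exact: prec_mono (lexx _) cab (leIl _ _).
  exact: prec_mono (lexx _) cab (leIr _ _).
Qed.

HB.instance Definition _ := Choice.on UlS.
HB.instance Definition _ :=
  isBaseTopological.Build UlS beta_cover beta_joint.

Definition int_tauS (U : set (Ul A)) : set (Ul A) := @interior UlS U.

Definition leS (x y : Ul A) : Prop :=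
  forall U : set (Ul A), clopen U -> int_tauS U x -> int_tauS U y.

Definition separated_leS : Prop :=
  forall x y : Ul A, ~ leS x y ->
    exists U : set (Ul A), [/\ clopen U, U x, ~ U y & U = int_tauS U].

End SubordinationTopology.

(* Main.v *)
Require Import Defs.
From mathcomp Require Import all_boot all_order.
From mathcomp Require Import all_classical topology_structure.

(** Everything is reduced to the Boolean prime ideal theorem
    [filter_ideal_separation]: a filter and an ideal that do not meet are
    separated by an ultrafilter.

    It turns the topological data into algebra.  The clopen sets of the Stone
    topology are exactly the [phi a] ([clopen_phi]), and [x] lies in the
    tau_S-interior of [phi a] iff [x] contains some [b ≺ a] ([int_tauS_phi]);
    [phi a] is tau_S-open iff [a ≺ a], because the [b ≺ a] form an ideal.  So
    [~ leS x y] means that for some [a] there is [b ≺ a] in [x] but none in [y],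
    and [separated_leS] asks, for such [x] and [y], for a reflexive [c]
    (that is, [c ≺ c]) in [x] and not in [y].

    If reflexive elements interpolate [≺], interpolating [b ≺ a] produces this
    [c].  Conversely let [a ≺ b].  Any [x] containing [a] and [y] omitting [b]
    satisfy [~ leS x y], hence are separated by a reflexive element.  Reflexive
    elements are closed under meets, so for a fixed [x] the upward closure of
    the reflexive elements of [x] is a filter; it contains [b], for otherwise it
    would extend to an ultrafilter [y] that omits [b] and contains every
    reflexive element of [x].  Thus every ultrafilter containing [a] contains a
    reflexive [c <= b].  Reflexive elements are also closed under joins, so the
    reflexive elements below [b] generate an ideal; it meets every ultrafilter
    containing [a], hence contains [a].  These two prime ideal arguments replace
    a double use of the compactness of the Stone space. *)

Set Implicit Arguments.
Unset Strict Implicit.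
Unset Printing Implicit Defensive.

Import Order.Theory.

Local Open Scope classical_set_scope.

Local Notation "a ∈ x" := (ul_set x a) (at level 70, no associativity).

(** * Ultrafilters of a Boolean algebra *)

Section BooleanAlgebra.
Context (d : Order.disp_t) (A : ctbDistrLatticeType d).
Implicit Types (a b c e : A) (F I : set A) (x y : Ul A).

Definition is_ideal I : Prop :=
  [/\ I \bot%O,
      (forall a b, I a -> I b -> I (a `|` b)%O) &
      (forall a b, (a <= b)%O -> I b -> I a)].

Lemma principal_filter_is_filter a : is_filter [set e | (a <= e)%O].
Proof.
split=> [|b c ab ac|b c bc ab] /=; first exact: lex1.
  by rewrite lexI ab ac.
exact: le_trans ab bc.
Qed.

Lemma principal_ideal_is_ideal a : is_ideal [set e | (e <= a)%O].
Proof.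
split=> [|b c ba ca|b c bc ca] /=; first exact: le0x.
  by rewrite leUx ba ca.
exact: le_trans bc ca.
Qed.

Lemma ultra_top x : \top%O ∈ x.
Proof. by case: (ul_setP x) => -[[]]. Qed.

Lemma ultra_meet x a b : a ∈ x -> b ∈ x -> (a `&` b)%O ∈ x.
Proof. by case: (ul_setP x) => -[[_ xI _] _] _; apply: xI. Qed.

Lemma ultra_up x a b : (a <= b)%O -> a ∈ x -> b ∈ x.
Proof. by case: (ul_setP x) => -[[_ _ xU] _] _; apply: xU. Qed.

Lemma ultra_bot x : ~ \bot%O ∈ x.
Proof. by case: (ul_setP x) => -[]. Qed.

Lemma proper_filter_in_ultra F : is_proper_filter F ->
  exists x, F `<=` x.
Proof.
move=> [[F1 FI FU] F0].
(* Joining [F] to each candidate makes the empty chain harmless: its union is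
   empty, and so corresponds to [F] itself. *)
pose P : set (set A) := [set G | is_proper_filter (F `|` G)].
have [C CP Ctot|G [PG Gmax]] := @Zorn_bigcup A P.
  split; last by case=> // -[G CG G0]; case: (CP _ CG) => _; apply; right.
  split; first by left.
  - move=> a b [Fa|[G CG Ga]] [Fb|[H CH Hb]]; first by left; apply: FI.
    + case: (CP _ CH) => -[_ HI _] _.
      by case: (HI a b (or_introl Fa) (or_intror Hb)); [left|right; exists H].
    + case: (CP _ CG) => -[_ GI _] _.
      by case: (GI a b (or_intror Ga) (or_introl Fb)); [left|right; exists G].
    + have [K [CK Ka Kb]] : exists K, [/\ C K, K a & K b].
        by case: (Ctot _ _ CG CH) => sub; [exists H|exists G]; split=> //; apply: sub.
      case: (CP _ CK) => -[_ KI _] _.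
      by case: (KI a b (or_intror Ka) (or_intror Kb)); [left|right; exists K].
  - move=> a b ab [Fa|[G CG Ga]]; first by left; apply: FU Fa.
    case: (CP _ CG) => -[_ _ GU] _.
    by case: (GU a b ab (or_intror Ga)); [left|right; exists G].
suff uG : is_ultrafilter (F `|` G) by exists (MkUl uG) => e; left.
split=> // H PH FGH; apply/seteqP; split=> // e He; right.
apply: contrapT => nGe; apply: (Gmax H).
  by split=> [f Gf|/(_ _ He)//]; apply: FGH; right.
by rewrite /P /= (_ : F `|` H = H) //; apply/setUidPr => f Ff; apply: FGH; left.
Qed.

(** Otherwise [x] and [a] would generate a proper filter larger than [x]. *)
Lemma ultra_compl x a : a ∈ x \/ (~` a)%O ∈ x.
Proof.
have [xNa|nxNa] := pselect ((~` a)%O ∈ x); [by right|left].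
pose G : set A := [set e | exists2 f, f ∈ x & (f `&` a <= e)%O].
suff PG : is_proper_filter G.
  case: (ul_setP x) => _ /(_ _ PG) <-; last by move=> f xf; exists f; rewrite ?leIl.
  by exists \top%O; [exact: ultra_top|rewrite leIr].
split; first split.
- by exists \top%O; [exact: ultra_top|exact: lex1].
- move=> b c [f xf fb] [g xg gc]; exists (f `&` g)%O; first exact: ultra_meet.
  rewrite lexI (le_trans _ fb) ?(le_trans _ gc) //.
    by rewrite leI2 ?leIr.
  by rewrite leI2 ?leIl.
- by move=> b c bc [f xf fb]; exists f => //; apply: le_trans bc.
- by move=> [f xf]; rewrite lex0 disj_leC => fNa; apply: nxNa; apply: ultra_up xf.
Qed.

Lemma ultra_prime x a b : (a `|` b)%O ∈ x -> a ∈ x \/ b ∈ x.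
Proof.
move=> xab; have [xa|xNa] := ultra_compl x a; [by left|right].
apply: ultra_up (ultra_meet xab xNa).
by rewrite meetUl meetxC join0x leIl.
Qed.

(** The filter generated by [F] and the complements of the elements of [I] is
    proper, and an ultrafilter extending it omits [I]. *)
Lemma filter_ideal_separation F I : is_filter F -> is_ideal I ->
  (forall e, F e -> I e -> False) ->
  exists x, F `<=` x /\ (forall e, I e -> ~ e ∈ x).
Proof.
move=> [F1 FI FU] [I0 IU ID] FI0.
pose G : set A := [set e | exists f i, [/\ F f, I i & (f <= e `|` i)%O]].
have [|x Gx] := @proper_filter_in_ultra G; last first.
  exists x; split=> [f Ff|i Ii xi].
    by apply: Gx; exists f, \bot%O; rewrite joinx0.
  apply: (@ultra_bot x); rewrite -(meetxC i); apply: ultra_meet => //.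
  by apply: Gx; exists \top%O, i; rewrite joinC joinxC.
split; last by move=> [f [i [Ff Ii]]]; rewrite join0x => /FU/(_ Ff)/FI0; apply.
split.
- by exists \top%O, \bot%O; split=> //; rewrite joinx0.
- move=> b c [f [i [Ff Ii fb]]] [g [j [Fg Ij gc]]].
  exists (f `&` g)%O, (i `|` j)%O; split; [exact: FI|exact: IU|].
  rewrite joinIl lexI; apply/andP; split.
    by rewrite (le_trans (leIl _ _)) // (le_trans fb) // leU2 // leUl.
  by rewrite (le_trans (leIr _ _)) // (le_trans gc) // leU2 // leUr.
- move=> b c bc [f [i [Ff Ii fb]]]; exists f, i; split=> //.
  by rewrite (le_trans fb) // leU2.
Qed.

Lemma phi_sub_le a b : phi a `<=` phi b -> (a <= b)%O.
Proof.
move=> ab; apply: contrapT => nab.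
have [e ae eb|x [ax bx]] := filter_ideal_separation
  (principal_filter_is_filter a) (principal_ideal_is_ideal b).
  by apply: nab; apply: le_trans ae eb.
by apply: (bx b); [exact: lexx|apply/ab/ax/lexx].
Qed.

Lemma open_phi a : open (phi a).
Proof.
exists [set phi a]; first by move=> _ ->; exists a.
by rewrite bigcup_set1.
Qed.

Lemma setC_phi a : ~` phi a = phi (~` a)%O.
Proof.
apply/seteqP; split=> x /=; first by case: (ultra_compl x a).
by move=> xNa xa; apply: (@ultra_bot x); rewrite -(meetxC a); apply: ultra_meet.
Qed.

Lemma phi_clopen a : clopen (phi a).
Proof.
split; first exact: open_phi.
by rewrite -[phi a]setCK setC_phi closedC; exact: open_phi.
Qed.

Lemma open_phi_nbhd (U : set (Ul A)) x : open U -> U x ->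
  exists2 a, a ∈ x & phi a `<=` U.
Proof.
move=> [D sD <-] [V DV Vx]; have [a _ aV] := sD _ DV.
by exists a; [move: Vx; rewrite -aV|rewrite aV => y Vy; exists V].
Qed.

(** Since [U] and its complement are both unions of basic open sets, the ideal
    generated by the [i] with [phi i] inside [U] and the [j] with [phi j]
    outside [U] meets every ultrafilter, so it contains [\top].  From a
    decomposition of [\top] as such a join, [U = phi i]. *)
Lemma clopen_phi (U : set (Ul A)) : clopen U -> exists a, U = phi a.
Proof.
move=> [oU cU].
pose I : set A := [set e | exists i j,
  [/\ phi i `<=` U, phi j `<=` ~` U & (e <= i `|` j)%O]].
have phi0 (V : set (Ul A)) : phi \bot%O `<=` V by move=> x /ultra_bot.
have phiU (V : set (Ul A)) i j : phi i `<=` V -> phi j `<=` V -> phi (i `|` j)%O `<=` V.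
  by move=> iV jV x /ultra_prime[/iV|/jV].
have idI : is_ideal I.
  split.
  - by exists \bot%O, \bot%O; split; rewrite ?le0x.
  - move=> b c [i [j [iU jU bij]]] [k [l [kU lU ckl]]].
    exists (i `|` k)%O, (j `|` l)%O; split; [exact: phiU|exact: phiU|].
    by rewrite joinACA leU2.
  - move=> b c bc [i [j [iU jU cij]]]; exists i, j; split=> //.
    exact: le_trans cij.
have [i [j [iU jU]]] : I \top%O.
  apply: contrapT => nI1.
  have [e|x [_ xI]] :=
      filter_ideal_separation (principal_filter_is_filter \top%O) idI.
    by rewrite /= le1x => /eqP -> /nI1.
  have [Ux|nUx] := pselect (U x).
    have [a xa aU] := open_phi_nbhd oU Ux.
    by apply: (xI a) => //; exists a, \bot%O; rewrite joinx0.
  have [a xa aU] := open_phi_nbhd (closed_openC cU) nUx.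
  by apply: (xI a) => //; exists \bot%O, a; rewrite join0x.
rewrite le1x => /eqP ij1; exists i; apply/seteqP; split=> // x Ux.
have : (i `|` j)%O ∈ x by rewrite ij1; exact: ultra_top.
by case/ultra_prime => // /jU.
Qed.

End BooleanAlgebra.

(** * The topology of the subordination *)

Section Subordination.
Context (d : Order.disp_t) (A : s4SubordinationAlgType d).
Implicit Types (a b c e : A) (x y : Ul A).

Lemma prec_join2 a b c e : a ≺ b -> c ≺ e -> (a `|` c)%O ≺ (b `|` e)%O.
Proof.
move=> ab ce; apply: prec_join.
  exact: prec_mono (lexx _) ab (leUl _ _).
exact: prec_mono (lexx _) ce (leUr _ _).
Qed.

Lemma prec_meet2 a b c e : a ≺ b -> c ≺ e -> (a `&` c)%O ≺ (b `&` e)%O.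
Proof.
move=> ab ce; apply: prec_meet.
  exact: prec_mono (leIl _ _) ab (lexx _).
exact: prec_mono (leIr _ _) ce (lexx _).
Qed.

(** If [x] lies in a basic open set [beta (prec_down c)] inside [phi a], some
    [b] in [x] has [b ≺ c]; interpolating [b ≺ e ≺ c], every ultrafilter
    containing [e] is in that basic open set, so [e <= a] and [b ≺ a]. *)
Lemma int_tauS_phi a x :
  int_tauS (phi a) x <-> exists2 b, b ∈ x & b ≺ a.
Proof.
rewrite /int_tauS /interior nbhsE; split=> [[_ [[D sD <-] [V DV Vx]] sub]|].
  have [c _ cV] := sD _ DV.
  move: (Vx); rewrite -cV => -[b [xb bc]].
  have [e [be ec]] := prec_dense _ _ bc.
  have ea : (e <= a)%O.
    by apply: phi_sub_le => y ye; apply: sub; exists V => //; rewrite -cV; exists e.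
  by exists b => //; apply: prec_mono (lexx _) be ea.
move=> [b xb ba]; exists (beta (prec_down a)); last first.
  by move=> y [e [ye /prec_le ea]]; apply: ultra_up ea ye.
split; last by exists b.
exists [set beta (prec_down a)]; first by move=> _ ->; exists a.
by rewrite bigcup_set1.
Qed.

Lemma phi_tauS_open_refl c : phi c = int_tauS (phi c) <-> c ≺ c.
Proof.
split=> [cE|cc]; last first.
  apply/seteqP; split=> x; first by move=> xc; apply/int_tauS_phi; exists c.
  by move=> /int_tauS_phi[b xb /prec_le bc]; apply: ultra_up bc xb.
(* The elements below [c] for [≺] form an ideal that every ultrafilter
   containing [c] meets. *)
have idc : is_ideal (prec_down c).
  split.
  - exact: prec_mono (lexx _) prec00 (le0x _).
  - by move=> a b; apply: prec_join.
  - by move=> a b ab bc; apply: prec_mono ab bc (lexx _).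
apply: contrapT => ncc.
have [e ce ec|x [cx xc]] :=
    filter_ideal_separation (principal_filter_is_filter c) idc.
  by apply: ncc; apply: prec_mono ce ec (lexx _).
have : phi c x by apply: cx; exact: lexx.
by rewrite cE => /int_tauS_phi[b xb bc]; apply: (xc b).
Qed.

(** * Separation by reflexive elements *)

Lemma leSPn x y :
  ~ leS x y <-> exists a b, [/\ b ∈ x, b ≺ a & forall e, e ≺ a -> ~ e ∈ y].
Proof.
split=> [nxy|[a [b [xb ba ya]]] /(_ _ (phi_clopen a))]; last first.
  by case/(_ _)/int_tauS_phi => [|e ye /ya//]; apply/int_tauS_phi; exists b.
apply: contrapT => nab; apply: nxy => U /clopen_phi[a ->].
move=> /int_tauS_phi[b xb ba]; apply: contrapT => nya; apply: nab.
exists a, b; split=> // e ea ye; apply: nya.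
by apply/int_tauS_phi; exists e.
Qed.

(** A separating set is clopen, hence some [phi c], and its being tau_S-open
    then says [c ≺ c]. *)
Lemma separated_leSP : separated_leS A <->
  forall x y, ~ leS x y -> exists c, [/\ c ≺ c, c ∈ x & ~ c ∈ y].
Proof.
split=> sep x y /sep.
  move=> [U [/clopen_phi[c ->] xc yc /phi_tauS_open_refl cc]].
  by exists c.
move=> [c [cc xc yc]]; exists (phi c); split=> //; first exact: phi_clopen.
exact/phi_tauS_open_refl.
Qed.

(** The choice of the reflexive element differs from one ultrafilter to the next;
    it is the closure of reflexive elements under meets (here) and joins (in
    [refl_ideal]) that lets one prime ideal argument handle all of them. *)
Lemma refl_filter x :
  is_filter [set e | exists c, [/\ c ≺ c, c ∈ x & (c <= e)%O]].
Proof.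
split.
- by exists \top%O; split; [exact: prec11|exact: ultra_top|exact: lexx].
- move=> a b [c [cc xc ca]] [e [ee xe eb]]; exists (c `&` e)%O.
  by split; [exact: prec_meet2|exact: ultra_meet|exact: leI2].
- by move=> a b ab [c [cc xc ca]]; exists c; split=> //; apply: le_trans ab.
Qed.

Lemma refl_ideal b :
  is_ideal [set e | exists c, [/\ c ≺ c, (c <= b)%O & (e <= c)%O]].
Proof.
split.
- by exists \bot%O; split; [exact: prec00|exact: le0x|exact: lexx].
- move=> a e [c [cc cb ac]] [f [ff fb ef]]; exists (c `|` f)%O.
  by split; [exact: prec_join2|rewrite leUx cb fb|exact: leU2].
- by move=> a e ae [c [cc cb ec]]; exists c; split=> //; apply: le_trans ec.
Qed.

End Subordination.

Theorem theorem18 (d : Order.disp_t) (A : s4SubordinationAlgType d) :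
  (forall a b : A, a ≺ b ->
     exists c : A, c ≺ c /\ (a <= c)%O /\ (c <= b)%O) <->
  separated_leS A.
Proof.
rewrite separated_leSP; split=> [interp x y /leSPn[a [b [xb ba ya]]]|sep a b ab].
  have [c [cc [bc ca]]] := interp _ _ ba.
  exists c; split=> //; first exact: ultra_up bc xb.
  by apply: ya; apply: prec_mono (lexx _) cc ca.
have below_b (x : Ul A) : a ∈ x -> exists c, [/\ c ≺ c, c ∈ x & (c <= b)%O].
  move=> xa; apply: contrapT => nc.
  have [e [c [cc xc ce]] eb|y [sub yb]] :=
      filter_ideal_separation (refl_filter x) (principal_ideal_is_ideal b).
    by apply: nc; exists c; split=> //; apply: le_trans ce eb.
  have [|c [cc xc yc]] := sep x y.
    by apply/leSPn; exists b, a; split=> // e /prec_le; apply: yb.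
  by apply: yc; apply: sub; exists c.
apply: contrapT => nc.
have [e ae [c [cc cb ec]]|x [ax xI]] :=
    filter_ideal_separation (principal_filter_is_filter a) (refl_ideal b).
  by apply: nc; exists c; split=> //; split=> //; apply: le_trans ae ec.
have [c [cc xc cb]] := below_b x (ax _ (lexx a)).
by apply: (xI c) => //; exists c.
Qed.
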